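(* Let $(X,d)$ be a Lorentzian metric space without chronological boundary. Let $\mathscr{Q}$ be the initial quasi-uniformity on $X$ of the family of maps $$d_p:X\to(\mathbb{R},\mathscr{Q}_{\mathbb{R}})\quad\text{and}\quad d^p:X\to(\mathbb{R},\mathscr{Q}_{\mathbb{R}}^{-1}),\qquad p\in X.$$ The topology associated with $\mathscr{Q}$, $\mathcal{T}(\mathscr{Q}^* )$, coincides with the Lorentzian metric space topology. The order associated with $\mathscr{Q}$, $\bigcap\mathscr{Q}$, is the extended causal relation $J$.
   Context: Let $X$ be a set and $d:X\times X\to[0,+\infty)$ a function. Notation: $d_x(y)=d^y(x)=d(x,y)$; $x\ll y$ iff $d(x,y)>0$; $I^+(x)=\{y: x\ll y\}$, $I^-(x)=\{y: y\ll x\}$; for $A\subset X$, $I^\pm(A)=\bigcup_{p\in A}I^\pm(p)$ and $I(A)=I^+(A)\cap I^-(A)$; $I(p,q):=I(\{p,q\})$. For $\epsilon>0$, $I_\epsilon=\{(x,y): d(x,y)\ge\epsilon\}$. $(X,d)$ is a Lorentzian metric space if: (i) $d(x,z)\ge d(x,y)+d(y,z)$ whenever $d(x,y)>0$ and $d(y,z)>0$; (ii) there is a topology $T$ on $X$ such that $d$ is continuous in the product topology and, for every $x,y\in X$ and $\epsilon>0$, the set $I_\epsilon\cap(\overline{I(x,y)}\times\overline{I(x,y)})$ is compact; (iii) for all $x\ne y$ there is $z\in X$ with $d(x,z)\ne d(y,z)$ or $d(z,x)\ne d(z,y)$. It has no chronological boundary if there is no $x$ with $d(x,\cdot)\equiv0$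 and no $x$ with $d(\cdot,x)\equiv0$; then the topology in (ii) is unique and is called the Lorentzian metric space topology. The extended causal relation is $J=\{(x,y): d(p,y)\ge d(p,x)\text{ and }d(x,p)\ge d(y,p)\ \forall p\in X\}$. A quasi-uniformity on $X$ is a filter $\mathscr{Q}$ on $X\times X$ all of whose elements contain the diagonal and such that for every $U\in\mathscr{Q}$ there is $V\in\mathscr{Q}$ with $V\circ V\subset U$. With $U^{-1}=\{(x,y):(y,x)\in U\}$, $\mathscr{Q}^{-1}=\{U^{-1}:U\in\mathscr{Q}\}$ is a quasi-uniformity and $\mathscr{Q}^*=\{U\cap V^{-1}:U,V\in\mathscr{Q}\}$ is a uniformity; $\mathcal{T}(\mathscr{Q}^* )$ is the topology in which the neighborhood filter of $x$ is generated by the sets $U[x]=\{y:(x,y)\in U\}$, $U\in\mathscr{Q}^*$; $\bigcap\mathscr{Q}=\bigcap_{U\in\mathscr{Q}}U$ is the associated preorder. $\mathscr{Q}_{\mathbb{R}}$ is the filter on $\mathbb{R}\times\mathbb{R}$ generated by the sets $\{(x,y): -t<y-x\}$, $t>0$. Given maps $f_\alpha:X\to(X_\alpha,\mathscr{Q}_\alpha)$ into quasi-uniform spaces, the initial quasi-uniformity is the filter on $X\times X$ generated by the sets $(f_\alpha\times f_\alpha)^{-1}(U)$, for all $\alpha$ and $U\in\mathscr{Q}_\alpha$. *)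

(* Defs.v *)
From HB Require Import structures.
From mathcomp Require Import all_boot all_order all_algebra.
From mathcomp Require Import all_classical all_reals all_analysis.
Import Order.TTheory GRing.Theory Num.Theory.
Import numFieldNormedType.Exports.

Set Implicit Arguments.
Unset Strict Implicit.
Unset Printing Implicit Defensive.

Local Open Scope classical_set_scope.
Local Open Scope ring_scope.

Section QuasiUniformity.
Local Open Scope relation_scope.

(* No properness is required of the filter: on the empty set the only filter
   containing the diagonal is improper. *)
Record quasi_uniformity (X : Type) := QuasiUniformity {
  qent : set_system (X * X);
  qent_filter : Filter qent;
  qent_diagonal : forall U, qent U -> diagonal `<=` U;
  qent_split_ex : forall U, qent U -> exists2 V, qent V & V \; V `<=` U
}.

Section Constructions.
Variable X : Type.
Implicit Type Q : quasi_uniformity X.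

Lemma generated_diagonal (B : set_system (X * X)) :
  (forall U, B U -> diagonal `<=` U) ->
  forall U, smallest Filter B U -> diagonal `<=` U.
Proof.
by move=> Bd; apply: smallest_sub.
Qed.

Lemma generated_split (B : set_system (X * X)) :
  (forall U, B U -> exists2 V, smallest Filter B V & V \; V `<=` U) ->
  forall U, smallest Filter B U ->
    exists2 V, smallest Filter B V & V \; V `<=` U.
Proof.
move=> Bs; apply: smallest_sub; last exact: Bs.
split.
- by exists setT => //; exact: filterT.
- move=> U V [U' BU' sU] [V' BV' sV]; exists (U' `&` V').
    exact: (@filterI _ _ (smallest_filter_filter B)).
  move=> xy [z [Uxz Vxz] [Uzy Vzy]].
  by split; [apply: sU; exists z | apply: sV; exists z].
- by move=> U V UV [W BW sW]; exists W => //; exact: subset_trans UV.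
Qed.

Definition qu_inv_ent Q : set_system (X * X) := [set U^-1 | U in qent Q].

Lemma qu_inv_filter Q : Filter (qu_inv_ent Q).
Proof. by apply: filter_inv; exact: qent_filter. Qed.

Lemma qu_inv_diagonal Q U : qu_inv_ent Q U -> diagonal `<=` U.
Proof. by move=> [V QV <-] [x y] dxy; apply: (qent_diagonal QV). Qed.

Lemma qu_inv_split Q U :
  qu_inv_ent Q U -> exists2 V, qu_inv_ent Q V & V \; V `<=` U.
Proof.
move=> [V QV <-]; have [W QW sW] := qent_split_ex QV.
exists (W^-1); first by exists W.
by move=> [x y] [z /= Wzx Wyz]; apply: sW; exists z.
Qed.

Definition qu_inv Q : quasi_uniformity X :=
  QuasiUniformity (qu_inv_filter Q) (@qu_inv_diagonal Q) (@qu_inv_split Q).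

Definition qu_star_ent Q : set_system (X * X) :=
  [set U `&` V^-1 | U in qent Q & V in qent Q].

Lemma qu_star_filter Q : Filter (qu_star_ent Q).
Proof.
have QF := qent_filter Q; split.
- exists setT; first exact: filterT.
  by exists setT; [exact: filterT | rewrite setTI].
- move=> _ _ [U QU [V QV <-]] [U' QU' [V' QV' <-]].
  exists (U `&` U'); first exact: filterI.
  exists (V `&` V'); first exact: filterI.
  by rewrite setIACA.
- move=> P W sW [U QU [V QV eP]]; rewrite -eP in sW.
  exists (U `|` W); first by apply: filterS QU; exact: subsetUl.
  exists (V `|` W^-1); first by apply: filterS QV; exact: subsetUl.
  apply/seteqP; split=> [[x y] /= [[Uxy|//] [Vyx|//]]|[x y] Wxy].
    by apply: sW.
  by split; right.
Qed.

Lemma qu_star_diagonal Q U : qu_star_ent Q U -> diagonal `<=` U.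
Proof.
move=> [V QV [W QW <-]] [x y] dxy.
by split; [exact: (qent_diagonal QV) | exact: (qent_diagonal QW)].
Qed.

Lemma qu_star_inv Q U : qu_star_ent Q U -> qu_star_ent Q U^-1.
Proof.
move=> [V QV [W QW <-]]; exists W => //; exists V => //.
by apply/seteqP; split=> -[x y] [].
Qed.

Lemma qu_star_split Q U :
  qu_star_ent Q U -> exists2 V, qu_star_ent Q V & V \; V `<=` U.
Proof.
move=> [V QV [W QW <-]].
have [V' QV' sV] := qent_split_ex QV; have [W' QW' sW] := qent_split_ex QW.
exists (V' `&` W'^-1); first by exists V' => //; exists W'.
move=> [x y] [z [/= Vxz Wzx] [/= Vzy Wyz]].
by split; [apply: sV; exists z | apply: sW; exists z].
Qed.

End Constructions.

Section Initial.
Variables (X I : Type) (Y : I -> Type) (f : forall i, X -> Y i).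
Variable Q : forall i, quasi_uniformity (Y i).

Definition initial_base : set_system (X * X) :=
  [set V | exists i, exists2 U, qent (Q i) U &
             V = (fun xy : X * X => (f i xy.1, f i xy.2)) @^-1` U].

Definition initial_ent : set_system (X * X) := smallest Filter initial_base.

Lemma initial_filter : Filter initial_ent.
Proof. exact: smallest_filter_filter. Qed.

Lemma initial_diagonal U : initial_ent U -> diagonal `<=` U.
Proof.
move: U; apply: generated_diagonal => _ [i [U QU ->]] [x y] /diagonalP ->.
exact: (qent_diagonal QU).
Qed.

Lemma initial_split U :
  initial_ent U -> exists2 V, initial_ent V & V \; V `<=` U.
Proof.
move: U; apply: generated_split => _ [i [U QU ->]].
have [V QV sV] := qent_split_ex QU.
exists ((fun xy : X * X => (f i xy.1, f i xy.2)) @^-1` V).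
  by apply: sub_gen_smallest; exists i, V.
by move=> [x y] [z Vxz Vzy]; apply: sV; exists (f i z).
Qed.

Definition initial_qu : quasi_uniformity X :=
  QuasiUniformity initial_filter initial_diagonal initial_split.

End Initial.

Section RealLine.
Variable R : realType.

Definition real_qu_base : set_system (R * R) :=
  [set [set xy | - t < xy.2 - xy.1] | t in [set t : R | 0 < t]].

Definition real_qu_ent : set_system (R * R) := smallest Filter real_qu_base.

Lemma real_qu_filter : Filter real_qu_ent.
Proof. exact: smallest_filter_filter. Qed.

Lemma real_qu_diagonal U : real_qu_ent U -> diagonal `<=` U.
Proof.
move: U; apply: generated_diagonal => _ [t /= t0 <-] [x y] /diagonalP -> /=.
by rewrite subrr oppr_lt0.
Qed.

Lemma real_qu_split U :
  real_qu_ent U -> exists2 V, real_qu_ent V & V \; V `<=` U.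
Proof.
move: U; apply: generated_split => _ [t /= t0 <-].
exists [set xy | - (t / 2) < xy.2 - xy.1].
  by apply: sub_gen_smallest; exists (t / 2) => //=; rewrite divr_gt0.
move=> [x y] [z /= xz zy]; rewrite [t]splitr opprD.
by rewrite -[y](subrK z) -addrA ltrD.
Qed.

Definition real_qu : quasi_uniformity R :=
  QuasiUniformity real_qu_filter real_qu_diagonal real_qu_split.

End RealLine.

End QuasiUniformity.

(* X seen as a uniform space whose entourages are the elements of Q^*; the
   library then gives it the topology generated by the sections U[x]. *)
Definition qu_space (X : Type) (Q : quasi_uniformity X) : Type := {classic X}.

HB.instance Definition _ (X : Type) (Q : quasi_uniformity X) :=
  Choice.on (qu_space Q).
HB.instance Definition _ (X : Type) (Q : quasi_uniformity X) :=
  isUniform.Build (qu_space Q) (qu_star_filter Q) (@qu_star_diagonal X Q)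
    (@qu_star_inv X Q) (@qu_star_split X Q).

Definition qu_topology (X : Type) (Q : quasi_uniformity X) : set_system X :=
  @open (qu_space Q).

(* [Topological X] is the type of topological structures on X (bundled with
   a decidable equality and a choice operator, which always exist). *)
Definition topspace (X : Type) (T : Topological X) : topologicalType :=
  Topological.Pack T.

Definition open_sets (X : Type) (T : Topological X) : set_system X :=
  @open (topspace T).

Section Lorentzian.
Variables (R : realType) (X : Type) (d : X -> X -> R).

Definition chron_future (p : X) : set X := [set y | 0 < d p y].
Definition chron_past (p : X) : set X := [set y | 0 < d y p].
Definition chron_hull (A : set X) : set X :=
  (\bigcup_(p in A) chron_future p) `&` (\bigcup_(p in A) chron_past p).
Definition chron_level (e : R) : set (X * X) := [set xy | e <= d xy.1 xy.2].

Definition lorentzian_topology (T : Topological X) : Prop :=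
  continuous (fun xy : topspace T * topspace T => d xy.1 xy.2) /\
  forall (x y : X) (e : R), 0 < e ->
    let C : set (topspace T) :=
      closure (chron_hull [set x; y] : set (topspace T)) in
    compact ((chron_level e : set (topspace T * topspace T)) `&` (C `*` C)).

Record lorentzian_metric_space : Prop := LorentzianMetricSpace {
  lms_ge0 : forall x y, 0 <= d x y;
  lms_reverse_triangle : forall x y z,
    0 < d x y -> 0 < d y z -> d x y + d y z <= d x z;
  lms_topology : exists T : Topological X, lorentzian_topology T;
  lms_distinguishing : forall x y, x <> y ->
    exists z, d x z <> d y z \/ d z x <> d z y
}.

Definition no_chronological_boundary : Prop :=
  ~ (exists x, forall y, d x y = 0) /\ ~ (exists x, forall y, d y x = 0).

Definition extended_causal : set (X * X) :=
  [set xy | forall p, d p xy.1 <= d p xy.2 /\ d xy.2 p <= d xy.1 p].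

(* The family of the maps d_p = d(p, .) (index [inl p]), with values in
   (R, Q_R), and d^p = d(., p) (index [inr p]), with values in (R, Q_R^-1). *)
Definition distance_maps (i : X + X) : X -> R :=
  match i with inl p => fun x => d p x | inr p => fun x => d x p end.

Definition distance_targets (i : X + X) : quasi_uniformity R :=
  match i with inl _ => real_qu R | inr _ => qu_inv (real_qu R) end.

Definition lorentzian_qu : quasi_uniformity X :=
  initial_qu distance_maps distance_targets.

End Lorentzian.

(* Main.v *)
(** The topology of [Q^*] is the coarsest one making every [d(p, .)] and
    [d(., p)] continuous, hence it is coarser than any Lorentzian topology [T].
    Conversely let [F] be its neighborhood filter at [x]. Choosing
    [p << x << q << q'] and [e = d(x, q) / 2], the set [I_e /\ (C * C)], with
    [C] the closure of [I(p, q')], is [T]-compact, and its first projection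
    belongs to [F]: it contains every [y] close to [x] as [(y, q)] lies in
    [I_e /\ (C * C)]. If a [T]-neighborhood [O] of [x] did not belong to [F],
    then [F] restricted to the complement of [O] would have a [T]-cluster
    point [z]. By continuity [z] and [x] have the same distances from and to
    all points, so [z = x] as [d] distinguishes points; but [x] is not a
    cluster point. *)
Require Import Defs.
From mathcomp Require Import all_boot all_order all_algebra.
From mathcomp Require Import all_classical all_reals all_analysis.
From mathcomp Require Import lra.
Import Order.TTheory GRing.Theory Num.Theory.
Import numFieldNormedType.Exports.

Local Open Scope classical_set_scope.
Local Open Scope ring_scope.

(** * Entourages of the real line *)

Section RealQuasiUniformity.
Context {R : realType}.

(** The generating sets are nested, the smaller of two values of [t] giving their intersection, so
    their supersets already form a filter. *)
Lemma real_qu_entP (U : set (R * R)) : real_qu_ent U <->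
  exists2 t : R, 0 < t & forall x y, - t < y - x -> U (x, y).
Proof.
split; last first.
  move=> [t t0 tU]; apply: (@filterS _ _ (real_qu_filter R)
    [set xy | - t < xy.2 - xy.1]); first by move=> [x y]; exact: tU.
  by apply: sub_gen_smallest; exists t.
move: U; apply: smallest_sub.
- split.
  + by exists 1.
  + move=> U V [t t0 tU] [s s0 sV]; exists (Num.min t s).
      by rewrite lt_min t0.
    move=> x y txy; split; [apply: tU|apply: sV]; apply: le_lt_trans txy;
      by rewrite lerN2 ge_min lexx ?orbT.
  + by move=> U V UV [t t0 tU]; exists t => // x y /tU /UV.
- by move=> _ [t /= t0 <-]; exists t.
Qed.

Lemma near_real_qu_ent {U : set (R * R)} (a : R) : real_qu_ent U ->
  \forall b \near a, U (a, b) /\ U (b, a).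
Proof.
move=> /real_qu_entP[t t0 tU]; near=> b.
have : `|a - b| < t by near: b; exact: cvgr_dist_lt.
by rewrite ltr_distl => /andP[h1 h2]; split; apply: tU; lra.
Unshelve. all: by end_near. Qed.

End RealQuasiUniformity.

(** * Basic entourages and the associated order *)

Section LorentzianQuasiUniformity.
Context {R : realType} {X : Type} {d : X -> X -> R}.

Lemma lorentzian_qu_left p {t : R} : 0 < t ->
  qent (lorentzian_qu d) [set xy | - t < d p xy.2 - d p xy.1].
Proof.
move=> t0; apply: sub_gen_smallest; exists (inl p).
exists [set xy | - t < xy.2 - xy.1] => //.
by apply: sub_gen_smallest; exists t.
Qed.

Lemma lorentzian_qu_right p {t : R} : 0 < t ->
  qent (lorentzian_qu d) [set xy | - t < d xy.1 p - d xy.2 p].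
Proof.
move=> t0; apply: sub_gen_smallest; exists (inr p).
exists [set xy | - t < xy.1 - xy.2] => //.
exists [set xy | - t < xy.2 - xy.1] => //.
by apply: sub_gen_smallest; exists t.
Qed.

Lemma lorentzian_qu_order :
  \bigcap_(U in qent (lorentzian_qu d)) U = extended_causal d.
Proof.
apply/seteqP; split=> [[x y] xyQ p|[x y] xyJ U]; last first.
  (* The sets containing [(x, y)] form a filter, so by minimality of the generated filter only the
     generators need checking. *)
  have FF : Filter [set U : set (X * X) | U (x, y)].
    by split=> [|A B ? ?|A B AB]; [by [] | split | exact: AB].
  move: U; apply: smallest_sub => // _ [[p|p] [U QU ->]] /=.
    by have /real_qu_entP[t t0] := QU; apply; have [/= + _] := xyJ p;
      rewrite -subr_ge0; apply: lt_le_trans; rewrite oppr_lt0.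
  have [V /real_qu_entP[t t0 tV] <-] := QU.
  apply: tV; have [/= _] := xyJ p.
  by rewrite -subr_ge0; apply: lt_le_trans; rewrite oppr_lt0.
(* Let [t] tend to 0 in the basic entourages. *)
split; apply/ler_addgt0Pr => t t0 /=.
- have /= := xyQ _ (lorentzian_qu_left p t0).
  by rewrite ltrBrDr addrC ltrBlDr => /ltW.
- have /= := xyQ _ (lorentzian_qu_right p t0).
  by rewrite ltrBrDr addrC ltrBlDr => /ltW.
Qed.

(** * Neighborhoods for [Q^*] and continuity of the distance maps *)

Lemma nbhs_qu_spaceP {Q : quasi_uniformity X} {x : qu_space Q} {A : set X} :
  nbhs x A <-> exists2 E, qu_star_ent Q E & forall y, E (x, y) -> A y.
Proof.
split=> [/nbhsP[E QE sE]|[E QE sE]].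
  by exists E => // y Exy; apply: sE; apply/xsectionP.
by apply/nbhsP; exists E => // y /xsectionP; exact: sE.
Qed.

(** Symmetrizing [U] turns the one-sided bounds of [Q] into the two-sided ones that continuity
    requires. *)
Lemma qu_space_near {Q : quasi_uniformity X} (x : qu_space Q) {U} : qent Q U ->
  nbhs x [set y : qu_space Q | U (x, y) /\ U (y, x)].
Proof.
move=> QU; apply/nbhs_qu_spaceP; exists (U `&` U^-1)%relation => //.
by exists U => //; exists U.
Qed.

Lemma qu_space_dist_from_continuous p :
  continuous (d p : qu_space (lorentzian_qu d) -> R).
Proof.
move=> x; apply/(@cvgrPdist_lt _ _ _ _ (nbhs_filter x)) => t t0.
apply: filterS (qu_space_near x (lorentzian_qu_left p t0)) => y /= [h1 h2].
by rewrite ltr_norml; apply/andP; split; lra.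
Qed.

Lemma qu_space_dist_to_continuous p :
  continuous (d ^~ p : qu_space (lorentzian_qu d) -> R).
Proof.
move=> x; apply/(@cvgrPdist_lt _ _ _ _ (nbhs_filter x)) => t t0.
apply: filterS (qu_space_near x (lorentzian_qu_right p t0)) => y /= [h1 h2].
by rewrite ltr_norml; apply/andP; split; lra.
Qed.

(** * The topology of [Q^*] is coarser than [T] *)

Section Topology.
Context {T : Topological X}.
Hypothesis dc : continuous (fun xy : topspace T * topspace T => d xy.1 xy.2).

Lemma dist_from_continuous p : continuous (d p : topspace T -> R).
Proof.
move=> x.
have px : (p : topspace T, y) @[y --> (x : topspace T)] -->
    (p : topspace T, x).
  by apply: cvg_pair; [exact: cvg_cst | exact: cvg_id].
exact: (cvg_comp _ _ px (dc (p, x))).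
Qed.

Lemma dist_to_continuous p : continuous (d ^~ p : topspace T -> R).
Proof.
move=> x.
have xp : (y, p : topspace T) @[y --> (x : topspace T)] -->
    (x, p : topspace T).
  by apply: cvg_pair; [exact: cvg_id | exact: cvg_cst].
exact: (cvg_comp _ _ xp (dc (x, p))).
Qed.

(** The [U] with this property form a filter, and for a generator it is the continuity of a distance
    map. Both orders of the pair are kept because entourages of [Q^*] have the form [U /\ V^-1]. *)
Lemma near_lorentzian_qu {U} (x : topspace T) : qent (lorentzian_qu d) U ->
  nbhs x [set y : topspace T | U (x, y) /\ U (y, x)].
Proof.
move: U; apply: smallest_sub.
- split.
  + by apply: filterE.
  + by move=> A B xA xB; apply: filterS2 xA xB => y [? ?] [? ?].
  + by move=> A B AB; apply: filterS => y [? ?]; split; exact: AB.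
- move=> _ [[p|p] [U QU ->]] /=.
    exact: (dist_from_continuous p x _ (near_real_qu_ent (d p x) QU)).
  have [V QV <-] := QU.
  apply: (@filterS _ _ (nbhs_filter x) _ _ _
    (dist_to_continuous p x _ (near_real_qu_ent (d x p) QV))).
  by move=> y [].
Qed.

Lemma nbhs_qu_space_sub (x : X) (A : set X) :
  nbhs (x : qu_space (lorentzian_qu d)) A -> nbhs (x : topspace T) A.
Proof.
move=> /nbhs_qu_spaceP[E [U QU [V QV <-]] sA].
apply: filterS2 (near_lorentzian_qu x QU) (near_lorentzian_qu x QV).
by move=> y [Uxy _] [_ Vyx]; exact: sA.
Qed.

End Topology.

(** Every neighborhood of [f z] meets every neighborhood of [a], and the real line is Hausdorff. *)
Lemma cluster_cvg_eq {S : topologicalType} {F : set_system S} {f : S -> R}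
    {z : S} {a : R} : Filter F ->
  {for z, continuous f} -> cluster F z -> f @ F --> a -> f z = a.
Proof.
move=> FF fz Fz Fa; apply: Rhausdorff => A B zA aB.
have [y [By Ay]] := Fz _ _ (Fa _ aB) (fz _ zA).
by exists (f y).
Qed.

Hypothesis hd : lorentzian_metric_space d.
Hypothesis hb : no_chronological_boundary d.

Lemma chron_future_nonempty x : exists y, 0 < d x y.
Proof.
have [hf _] := hb; apply/not_existsP => h; apply: hf; exists x => y.
by apply/eqP; rewrite eq_le (lms_ge0 hd) andbT leNgt; apply/negP/h.
Qed.

Lemma chron_past_nonempty x : exists y, 0 < d y x.
Proof.
have [_ hp] := hb; apply/not_existsP => h; apply: hp; exists x => y.
by apply/eqP; rewrite eq_le (lms_ge0 hd) andbT leNgt; apply/negP/h.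
Qed.

Lemma chron_trans {y x z} : 0 < d x y -> 0 < d y z -> 0 < d x z.
Proof.
move=> xy yz; apply: lt_le_trans (lms_reverse_triangle hd xy yz).
exact: addr_gt0.
Qed.

Lemma chron_hull_between {p q x} : 0 < d p x -> 0 < d x q ->
  chron_hull d [set p; q] x.
Proof. by move=> px xq; split; [exists p; [left|] | exists q; [right|]]. Qed.

(** * The topology of [Q^*] is finer than [T] *)

Section LorentzianTopology.
Context {T : Topological X}.
Hypothesis hT : lorentzian_topology d T.

Lemma nbhs_qu_space_compact (x : X) : exists2 K : set (topspace T),
  compact K & nbhs (x : qu_space (lorentzian_qu d)) K.
Proof.
have [p px] := chron_past_nonempty x; have [q xq] := chron_future_nonempty x.
(* The extra point [q'] puts [q] itself inside the hull of [p] and [q']. *)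
have [q' qq'] := chron_future_nonempty q.
have xq' := chron_trans xq qq'; have pq := chron_trans px xq.
(* Halving makes the bound strict at [x], so that it persists nearby. *)
have e0 : 0 < d x q / 2 by rewrite divr_gt0.
have exq : d x q / 2 < d x q by rewrite ltr_pdivrMr// ltr_pMr// ltr1n.
exists (@fst (topspace T) (topspace T) @` (chron_level d (d x q / 2) `&`
    (closure (chron_hull d [set p; q'] : set (topspace T)) `*`
     closure (chron_hull d [set p; q'] : set (topspace T))))).
  apply: (@continuous_compact (topspace T * topspace T)%type (topspace T));
    last by have [_] := hT; apply.
  by apply: continuous_subspaceT => z; exact: cvg_fst.
have FF : Filter (nbhs (x : qu_space (lorentzian_qu d))) by exact: nbhs_filter.
have near1 := @cvgr_gt _ _ _ FF _ _ (qu_space_dist_from_continuous p x) _ px.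
have near2 := @cvgr_gt _ _ _ FF _ _ (qu_space_dist_to_continuous q' x) _ xq'.
have near3 := @cvgr_gt _ _ _ FF _ _ (qu_space_dist_to_continuous q x) _ exq.
apply: (@filterS3 _ _ FF _ _ _ _ _ near1 near2 near3) => y /= py yq' eyq.
exists (y, q) => //; split; first exact: ltW.
by split; apply: subset_closure; apply: chron_hull_between.
Qed.

Lemma nbhs_lorentzian_topology_sub (x : X) (A : set X) :
  nbhs (x : topspace T) A -> nbhs (x : qu_space (lorentzian_qu d)) A.
Proof.
move=> xA; apply: contrapT => nA; have [dc _] := hT.
have [K cK xK] := nbhs_qu_space_compact x.
have QF := nbhs_filter (x : qu_space (lorentzian_qu d)).
(* The [Q^*]-neighborhoods of [x] traced on the complement of [A], read as a filter on [T] so that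
   the [T]-compactness of [K] applies. *)
pose F : set_system (topspace T) :=
  within (~` A) (nbhs (x : qu_space (lorentzian_qu d))).
have FF : ProperFilter F.
  split; last exact: (@within_filter _ _ _ QF).
  by move=> F0; apply: nA; apply: (@filterS _ _ QF _ _ _ F0) => y /= /contrapT.
have xF : F `=>` nbhs (x : qu_space (lorentzian_qu d)).
  by move=> B xB; apply: (@filterS _ _ QF _ _ _ xB) => y.
have [z [_ Fz]] := cK F _ (xF _ xK).
have zx : z = x.
  (* The distances to and from [w] are [T]-continuous at [z], and along [F] they converge to their
     values at [x]. *)
  apply: contrapT => /(lms_distinguishing hd)[w []]; apply.
    apply: (cluster_cvg_eq _ (dist_to_continuous dc w z) Fz).
    by apply: cvg_trans (qu_space_dist_to_continuous w x) => B /xF.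
  apply: (cluster_cvg_eq _ (dist_from_continuous dc w z) Fz).
  by apply: cvg_trans (qu_space_dist_from_continuous w x) => B /xF.
rewrite zx in Fz.
(* As a cluster point of [F], [x] would have its neighborhood [A] meet the complement of [A]. *)
have FA : F (~` A) by apply: (@filterE _ _ QF) => y.
by have [y [/= nAy /nAy]] := Fz _ _ FA xA.
Qed.

Lemma qu_topology_lorentzian : qu_topology (lorentzian_qu d) = open_sets T.
Proof.
have [dc _] := hT.
apply/seteqP; split=> A; rewrite /qu_topology /open_sets /=.
  rewrite openE => oA; rewrite openE => x /oA; exact: nbhs_qu_space_sub.
by rewrite openE => oA; rewrite openE => x /oA;
  exact: nbhs_lorentzian_topology_sub.
Qed.

End LorentzianTopology.

End LorentzianQuasiUniformity.

Theorem theorem7p10 (R : realType) (X : Type) (d : X -> X -> R)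
    (hd : lorentzian_metric_space d) (hb : no_chronological_boundary d) :
  (forall T : Topological X, lorentzian_topology d T ->
     qu_topology (lorentzian_qu d) = open_sets T) /\
  \bigcap_(U in qent (lorentzian_qu d)) U = extended_causal d.
Proof.
split; last exact: lorentzian_qu_order.
by move=> T; exact: qu_topology_lorentzian.
Qed.
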